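(* Let $G$ be an embedded graph. Then $$P(G;\lambda)=\sum_{A\subseteq E(G)}(-1)^{|A|}\,\chi\big((G^{\tau(A)})^*;\lambda\big).$$
   Context: An embedded graph is a graph (loops and multiple edges allowed, not necessarily connected) cellularly embedded in a closed, possibly non-orientable, surface, i.e. each component of the complement (each face) is an open disc. Equivalently, it is a ribbon graph: a surface with boundary written as a union of vertex discs and edge discs (ribbons), each edge disc meeting the vertex discs in exactly two disjoint arcs. $f(G)$ is the number of boundary components of the ribbon graph (number of faces). The partial Petrial $G^{\tau(A)}$, $A\subseteq E(G)$, is the ribbon graph obtained from $G$ by adding a half-twist to each edge in $A$. $G^*$ denotes the geometric dual of an embedded graph $G$. Penrose polynomial: $P(G;\lambda)=\sum_{A\subseteq E(G)}(-1)^{|A|}\lambda^{f(G^{\tau(A)})}$. $\chi(H;\lambda)$ is the chromatic polynomial of the underlying abstract graph of $H$ (it is $0$ if $H$ has a loop). *)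

(* Defs.v *)
From HB Require Import structures.
From mathcomp Require Import all_boot all_order all_algebra.

Set Implicit Arguments.
Unset Strict Implicit.
Unset Printing Implicit Defensive.

Import Order.TTheory GRing.Theory Num.Theory.
Local Open Scope ring_scope.

(** Loops and multiple edges are allowed; [e] is a loop when [#|ends e| = 1]. *)
Record multigraph := Multigraph {
  node : finType;
  link : finType;
  ends : link -> {set node};
  ends_card : forall e, (0 < #|ends e| <= 2)%N
}.

(** The two ends of each edge get different colours; as [#|ends e|] is 1 for a
    loop, a graph with a loop has no proper colouring. *)
Definition proper_colouring (H : multigraph) (n : nat)
    (c : {ffun node H -> 'I_n}) : bool :=
  [forall e : link H, #|c @: ends e| == 2%N].

Definition n_colourings (H : multigraph) (n : nat) : nat :=
  #|[set c : {ffun node H -> 'I_n} | proper_colouring c]|.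

Lemma card_ffun_invariant (T : finType) (e : rel T) (n : nat) :
  connect_sym e ->
  #|[set c : {ffun T -> 'I_n} | [forall x, forall y, e x y ==> (c x == c y)]]|
    = (n ^ n_comp e predT)%N.
Proof.
move=> symE; pose R : finType := {x : T | roots e x}.
have rP x : roots e (fingraph.root e x) by exact: roots_root.
pose ext (g : {ffun R -> 'I_n}) : {ffun T -> 'I_n} :=
  [ffun x => g (exist _ (fingraph.root e x) (rP x))].
have ext_inj : injective ext.
  move=> g h /ffunP gh; apply/ffunP => -[x rx]; have := gh x; rewrite !ffunE.
  set u := exist _ _ _; suff -> : u = exist (fun x => is_true (roots e x)) x rx by [].
  by apply: val_inj => /=; apply/eqP.
have -> : [set c : {ffun T -> 'I_n} |
            [forall x, forall y, e x y ==> (c x == c y)]]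
          = ext @: [set: {ffun R -> 'I_n}].
  apply/setP=> c; rewrite inE; apply/idP/imsetP.
  - move=> /'forall_forallP cE.
    have cP x y : connect e x y -> c x = c y.
      case/connectP=> p; elim: p x => [|z p IH] x /=; first by move=> _ ->.
      case/andP=> xz zp ly; rewrite -(IH z) //.
      by apply/eqP; apply: (implyP (cE x z)).
    exists [ffun u : R => c (val u)] => //; apply/ffunP=> x; rewrite !ffunE /=.
    by apply: cP; exact: connect_root.
  - case=> g _ ->; apply/'forall_forallP => x y; apply/implyP => xy; rewrite !ffunE.
    apply/eqP; congr (g _); apply: val_inj => /=.
    by apply/(fingraph.rootP symE); exact: connect1.
rewrite card_imset // cardsT card_ffun card_ord; congr (_ ^ _)%N.
by rewrite card_sig; apply: eq_card => x; rewrite !inE andbT.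
Qed.

Lemma chromatic_poly_exists (H : multigraph) :
  {p : {poly int} | forall n : nat, p.[n%:R] = (n_colourings H n)%:R}.
Proof.
pose r (A : {set link H}) : rel (node H) :=
  fun u v => [exists e in A, (u \in ends e) && (v \in ends e)].
have symr A : connect_sym (r A).
  apply: sym_connect_sym => u v; apply: eq_existsb => e.
  by rewrite [in RHS](andbC (v \in _)).
exists (\sum_(A : {set link H}) (-1) ^+ #|A| * 'X^(n_comp (r A) predT)) => n.
pose C : finType := {ffun node H -> 'I_n}.
pose mono (c : C) (e : link H) := #|c @: ends e| != 2%N.
have monoP (c : C) (e : link H) : reflect {in ends e &, forall u v, c u = c v} (mono c e).
  have /andP[e0 e2] := ends_card e.
  apply: (iffP idP) => [m2 u v ue ve | ce].
  - have le1 : (#|c @: ends e| <= 1)%N.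
      have := leq_trans (leq_imset_card c (mem (ends e))) e2.
      by rewrite leq_eqVlt (negPf m2).
    by apply: (card_le1_eqP le1); apply: imset_f.
  - case/card_gt0P: e0 => u ue; rewrite /mono.
    suff -> : c @: ends e = [set c u] by rewrite cards1.
    apply/setP=> k; rewrite inE; apply/imsetP/eqP => [[v ve ->]|->]; first exact: ce.
    by exists u.
have -> : (n_colourings H n)%:R =
    \sum_(c : C) \prod_(e : link H) (- (mono c e)%:R + 1 : int).
  rewrite /n_colourings -sum1_card natr_sum big_mkcond; apply: eq_bigr => c _.
  rewrite inE /proper_colouring; case: ifPn => [/forallP pc | ].
  - by rewrite big1 // => e _; rewrite /mono pc oppr0 add0r.
  - rewrite negb_forall => /existsP[e me].
    by rewrite (bigD1 e) //= /mono me addNr mul0r.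
rewrite (eq_bigr (fun c => \sum_(A : {set link H})
  \prod_e (if e \in A then - (mono c e)%:R else 1))); last first.
  by move=> c _; exact: bigA_distr.
rewrite exchange_big horner_sum /=; apply: eq_bigr => A _.
have sgnE : ((-1) ^+ #|A|).[n%:R] = (-1) ^+ #|A| :> int.
  by rewrite horner_exp hornerN hornerC.
rewrite hornerM hornerXn sgnE -natrX -card_ffun_invariant //.
set m := (-1) ^+ #|A|; rewrite -sum1_card natr_sum mulr_sumr /m {m sgnE}.
rewrite big_mkcond /=; apply: eq_bigr => c _; rewrite inE -big_mkcond /=.
case: ifPn => [/'forall_forallP cA | ].
- rewrite mulr1 (eq_bigr (fun=> -1)) ?prodr_const // => e eA.
  suff -> : mono c e by [].
  apply/monoP => u v ue ve; apply/eqP/(implyP (cA u v)).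
  by apply/existsP; exists e; rewrite eA ue.
- rewrite negb_forall => /existsP[u]; rewrite negb_forall => /existsP[v].
  rewrite negb_imply => /andP[/existsP[e /and3P[eA ue ve]] cuv].
  rewrite (bigD1 e) //= (_ : mono c e = false) ?oppr0 ?mul0r //.
  by apply/monoP => /(_ u v ue ve) /eqP; rewrite (negPf cuv).
Qed.

Definition chromatic_poly (H : multigraph) : {poly int} :=
  sval (chromatic_poly_exists H).

Lemma chromatic_polyE (H : multigraph) (n : nat) :
  (chromatic_poly H).[n%:R] = (n_colourings H n)%:R.
Proof. exact: (svalP (chromatic_poly_exists H)). Qed.

Lemma poly_eq_on_nat (p q : {poly int}) :
  (forall n : nat, p.[n%:R] = q.[n%:R]) -> p = q.
Proof.
move=> pq; apply/eqP; rewrite -subr_eq0; apply/negP => /negP nz.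
pose s : seq int := [seq i%:R | i <- iota 0 (size (p - q))].
have := @max_poly_roots _ (p - q) s nz; rewrite size_map size_iota ltnn.
move=> H; suff: false by []; apply: H.
  apply/allP => _ /mapP[i _ ->].
  by rewrite /root hornerD hornerN pq subrr.
by rewrite map_inj_uniq ?iota_uniq // => i j /eqP; rewrite eqr_nat => /eqP.
Qed.

Lemma chromatic_poly_unique (H : multigraph) (p : {poly int}) :
  (forall n : nat, p.[n%:R] = (n_colourings H n)%:R) -> p = chromatic_poly H.
Proof. by move=> pE; apply: poly_eq_on_nat => n; rewrite pE chromatic_polyE. Qed.

(** A ribbon graph (embedded graph) is encoded by its flags.  The flags are the
    corners of the edge discs, i.e. the endpoints of the arcs in which edge
    discs meet vertex discs, four for each edge disc.  From a corner one moves
    - with [t0] along the side of the edge disc, towards its other end;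
    - with [t1] along the free part of the boundary of the vertex disc, to a
      corner of the next edge disc (or of the same one);
    - with [t2] along the arc, to the other corner at the same end of the same
      edge disc.
    A vertex disc without edges has no flag, hence the extra set [isolated].
    Neither orientability nor connectedness is assumed. *)
Record ribbon_graph := RibbonGraph {
  flag : finType;
  isolated : finType;
  t0 : flag -> flag;
  t1 : flag -> flag;
  t2 : flag -> flag;
  t0K : involutive t0;
  t1K : involutive t1;
  t2K : involutive t2;
  t0_free : forall x, t0 x != x;
  t1_free : forall x, t1 x != x;
  t2_free : forall x, t2 x != x;
  t02C : forall x, t0 (t2 x) = t2 (t0 x);
  t02_free : forall x, t0 (t2 x) != x
}.

Definition orbit2 (T : finType) (f g : T -> T) (x : T) : {set T} :=
  [set y | connect [rel u v | (v == f u) || (v == g u)] x y].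

Definition orbits2 (T : finType) (f g : T -> T) : finType :=
  {C : {set T} | C \in [set orbit2 f g x | x in T]}.

Definition orbit2_of (T : finType) (f g : T -> T) (x : T) : orbits2 f g :=
  exist _ (orbit2 f g x) (imset_f (orbit2 f g) (erefl : x \in T)).

Definition edge (G : ribbon_graph) : finType := orbits2 (@t0 G) (@t2 G).
Definition edge_of (G : ribbon_graph) (x : flag G) : edge G :=
  orbit2_of (@t0 G) (@t2 G) x.

Definition vertex (G : ribbon_graph) : finType :=
  (orbits2 (@t1 G) (@t2 G) + isolated G)%type.
Definition vertex_of (G : ribbon_graph) (x : flag G) : vertex G :=
  inl (orbit2_of (@t1 G) (@t2 G) x).

(** The boundary components: an isolated vertex disc has one of its own. *)
Definition face (G : ribbon_graph) : finType :=
  (orbits2 (@t0 G) (@t1 G) + isolated G)%type.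
Definition n_faces (G : ribbon_graph) : nat := #|face G|.

Lemma orbit2_eq (T : finType) (f g : T -> T) :
  involutive f -> involutive g -> forall x y,
  connect [rel u v | (v == f u) || (v == g u)] x y ->
  orbit2_of f g x = orbit2_of f g y.
Proof.
move=> fK gK x y xy; apply: val_inj; apply/setP => z; rewrite !inE.
apply: same_connect xy z; apply: sym_connect_sym => u v /=.
by congr (_ || _); rewrite eq_sym ?(inv_eq fK) ?(inv_eq gK).
Qed.

Lemma edge_of_t0 (G : ribbon_graph) (x : flag G) : edge_of (t0 x) = edge_of x.
Proof.
by apply/esym/orbit2_eq; [exact: t0K | exact: t2K | apply: connect1; rewrite /= eqxx].
Qed.

Lemma edge_of_t2 (G : ribbon_graph) (x : flag G) : edge_of (t2 x) = edge_of x.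
Proof.
apply/esym/orbit2_eq; [exact: t0K | exact: t2K | apply: connect1].
by rewrite /= eqxx orbT.
Qed.

Lemma vertex_of_t2 (G : ribbon_graph) (x : flag G) :
  vertex_of (t2 x) = vertex_of x.
Proof.
congr inl; apply/esym/orbit2_eq; [exact: t1K | exact: t2K | apply: connect1].
by rewrite /= eqxx orbT.
Qed.

Definition edge_ends (G : ribbon_graph) (e : edge G) : {set vertex G} :=
  [set vertex_of x | x in val e].

Lemma edge_endsE (G : ribbon_graph) (x : flag G) :
  edge_ends (edge_of x) = [set vertex_of x; vertex_of (t0 x)].
Proof.
apply/setP => v; rewrite !inE; apply/imsetP/orP => [[y]|].
- rewrite inE => /connectP[p xp ->] ->; elim: p x xp => [|z p IH] x /=.
    by rewrite eqxx; left.
  case/andP=> /orP[]/eqP-> /IH; rewrite ?t0K ?t02C ?vertex_of_t2 //.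
  by case; [right | left].
- case=> /eqP->; [exists x | exists (t0 x)] => //; rewrite inE ?connect0 //.
  by apply: connect1; rewrite /= eqxx.
Qed.

Lemma edge_ends_card (G : ribbon_graph) (e : edge G) :
  (0 < #|edge_ends e| <= 2)%N.
Proof.
have [x ->] : exists x, e = edge_of x.
  by case: e => C CP; case/imsetP: (CP) => x _ eC; exists x; apply: val_inj.
by rewrite edge_endsE cards2; case: eqP.
Qed.

Definition underlying_graph (G : ribbon_graph) : multigraph :=
  Multigraph (@edge_ends_card G).

(** The geometric dual interchanges vertices and faces; flags correspond to
    incident (vertex, edge, face) triples, so this is the exchange of [t0] and
    [t2].  The dual of an isolated vertex is an isolated vertex. *)
Lemma dual_comm (G : ribbon_graph) (x : flag G) : t2 (t0 x) = t0 (t2 x).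
Proof. by rewrite t02C. Qed.

Lemma dual_free (G : ribbon_graph) (x : flag G) : t2 (t0 x) != x.
Proof. by rewrite -t02C t02_free. Qed.

Definition dual (G : ribbon_graph) : ribbon_graph :=
  @RibbonGraph (flag G) (isolated G) (@t2 G) (@t1 G) (@t0 G)
    (@t2K G) (@t1K G) (@t0K G) (@t2_free G) (@t1_free G) (@t0_free G)
    (@dual_comm G) (@dual_free G).

(** A half-twist of an edge disc makes each of its sides lead to the opposite
    corner of the other end. *)
Definition twist (G : ribbon_graph) (A : {set edge G}) (x : flag G) : flag G :=
  if edge_of x \in A then t0 (t2 x) else t0 x.

Lemma twistK (G : ribbon_graph) (A : {set edge G}) : involutive (twist A).
Proof.
move=> x; rewrite /twist; case: (boolP (edge_of x \in A)) => xA.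
  by rewrite edge_of_t0 edge_of_t2 xA t02C t0K t2K.
by rewrite edge_of_t0 (negPf xA) t0K.
Qed.

Lemma twist_free (G : ribbon_graph) (A : {set edge G}) x : twist A x != x.
Proof. by rewrite /twist; case: ifP; rewrite ?t02_free ?t0_free. Qed.

Lemma twist_comm (G : ribbon_graph) (A : {set edge G}) x :
  twist A (t2 x) = t2 (twist A x).
Proof. by rewrite /twist edge_of_t2; case: ifP; rewrite t02C. Qed.

Lemma twist_t2_free (G : ribbon_graph) (A : {set edge G}) x :
  twist A (t2 x) != x.
Proof.
by rewrite /twist edge_of_t2; case: ifP; rewrite ?t2K ?t0_free ?t02_free.
Qed.

Definition partial_petrial (G : ribbon_graph) (A : {set edge G}) :
    ribbon_graph :=
  @RibbonGraph (flag G) (isolated G) (twist A) (@t1 G) (@t2 G)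
    (twistK A) (@t1K G) (@t2K G) (twist_free A) (@t1_free G) (@t2_free G)
    (twist_comm A) (twist_t2_free A).

Definition penrose_poly (G : ribbon_graph) : {poly int} :=
  \sum_(A : {set edge G}) (-1) ^+ #|A| * 'X^(n_faces (partial_petrial A)).

(* Main.v *)
(** Evaluate both sides at a natural number [n] and count colourings of flags
    instead of colourings of faces.  For a fixed colouring that is invariant
    under [t1], the alternating sum over [A] factors over the edges: [e]
    contributes [a - b], where [a] (resp. [b]) tells whether the colouring is
    constant along the sides of [e] untwisted (resp. twisted).  In the chromatic
    sum, this factor is multiplied by the indicator that the two sides of [e]
    get different colours; this changes nothing, because [a = b] as soon as the
    two corners at some end of [e] have the same colour. *)
Require Import Defs.
From HB Require Import structures.
From mathcomp Require Import all_boot all_order all_algebra.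

Set Implicit Arguments.
Unset Strict Implicit.
Unset Printing Implicit Defensive.

Import Order.TTheory GRing.Theory Num.Theory.
Local Open Scope ring_scope.

(** * Indicators and cardinalities as integers *)

Lemma natr_forall (T : finType) (P : pred T) :
  [forall x, P x]%:R = \prod_x (P x)%:R :> int.
Proof.
case: forallP => [Pall | /forallP]; first by rewrite big1 // => x _; rewrite Pall.
by rewrite negb_forall => /existsP[x /negPf Px]; rewrite (bigD1 x) //= Px mul0r.
Qed.

Lemma natr_card (T : finType) (P : pred T) :
  #|[set x | P x]|%:R = \sum_x (P x)%:R :> int.
Proof.
rewrite -sum1_card natr_sum big_mkcond; apply: eq_bigr => x _.
by rewrite inE; case: (P x).
Qed.

(** * Orbits of flags: faces, dual vertices, edges *)

Lemma orbit2_ofP (T : finType) (f g : T -> T) (C : orbits2 f g) :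
  exists x, C = orbit2_of f g x.
Proof. by case: C => C CP; case/imsetP: (CP) => x _ Cx; exists x; apply: val_inj. Qed.

(** Faces and dual vertices list the generators [t0] and [t1] in opposite orders, which makes them
    distinct types. *)
Lemma card_orbits2C (T : finType) (f g : T -> T) :
  #|orbits2 f g| = #|orbits2 g f|.
Proof.
rewrite !card_sig; apply: eq_card => C; rewrite !inE.
suff oC x : orbit2 f g x = orbit2 g f x.
  by apply/imsetP/imsetP => -[x _ ->]; exists x.
apply/setP => y; rewrite !inE; apply: eq_connect => u v /=; exact: orbC.
Qed.

Lemma n_faces_dual (G : ribbon_graph) : n_faces G = #|vertex (dual G)|.
Proof. by rewrite /n_faces !card_sum card_orbits2C. Qed.

Lemma mem_edge_of (G : ribbon_graph) (x : flag G) : x \in val (edge_of x).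
Proof. by rewrite inE connect0. Qed.

Lemma edge_of_mem (G : ribbon_graph) (e : edge G) (x : flag G) :
  x \in val e -> e = edge_of x.
Proof.
have [y ->] := orbit2_ofP e; rewrite inE => yx.
by apply: orbit2_eq => //; [exact: t0K | exact: t2K].
Qed.

Lemma forall_edge_of (G : ribbon_graph) (P : pred (flag G)) (x : flag G) :
  [forall y in val (edge_of x), P y]
    = [&& P x, P (t0 x), P (t2 x) & P (t0 (t2 x))].
Proof.
apply/'forall_implyP/and4P => [Pe | [Px P0 P2 P02] y].
  have xx := mem_edge_of x.
  split; apply: Pe => //.
  - by rewrite -[X in val X](edge_of_t0 x) mem_edge_of.
  - by rewrite -[X in val X](edge_of_t2 x) mem_edge_of.
  - by rewrite -[X in val X](edge_of_t2 x) -edge_of_t0 mem_edge_of.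
rewrite inE => /connectP[p xp ->{y}].
(* As [t0] and [t2] are commuting involutions, a step along either only permutes the four
   corners. *)
elim: p x xp Px P0 P2 P02 => [|z p IH] x //= /andP[/orP[]/eqP-> zp] Px P0 P2 P02.
  by apply: IH; rewrite ?t0K -?t02C ?t0K.
by apply: IH; rewrite ?t2K.
Qed.

Lemma forall_flag_edge (G : ribbon_graph) (P : pred (flag G)) :
  [forall x, P x] = [forall e : edge G, [forall x in val e, P x]].
Proof.
apply/forallP/forallP => [Pall e | Pe x]; first by apply/'forall_implyP.
by have /'forall_implyP := Pe (edge_of x); apply; exact: mem_edge_of.
Qed.

(** * Vertex colourings pulled back to flags *)

Section FlagColourings.

Variables (G : ribbon_graph) (n : nat).
Local Notation colouring := {ffun flag G + isolated G -> 'I_n}.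

(** The summand [isolated G] makes this map surjective, so that pulling back is injective on
    colourings. *)
Definition incident_vertex (u : flag G + isolated G) : vertex G :=
  match u with inl x => vertex_of x | inr i => inr i end.

Definition pull_colouring (k : {ffun vertex G -> 'I_n}) : colouring :=
  [ffun u => k (incident_vertex u)].

Definition vertex_invariant (c : colouring) : bool :=
  [forall x, (c (inl (t1 x)) == c (inl x)) && (c (inl (t2 x)) == c (inl x))].

Lemma incident_vertexP (v : vertex G) : exists u, v = incident_vertex u.
Proof.
case: v => [C | i]; last by exists (inr i).
by have [x ->] := orbit2_ofP C; exists (inl x).
Qed.

Lemma pull_colouring_inj : injective pull_colouring.
Proof.
move=> k l /ffunP kl; apply/ffunP => v; have [u ->] := incident_vertexP v.
by have := kl u; rewrite !ffunE.
Qed.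

Lemma pull_colouringP (c : colouring) :
  reflect (exists k, c = pull_colouring k) (vertex_invariant c).
Proof.
apply: (iffP forallP) => [cI | [k ->] x]; last first.
  rewrite !ffunE /= vertex_of_t2 eqxx andbT; apply/eqP; congr (k (inl _)).
  apply/esym/orbit2_eq; [exact: t1K | exact: t2K | apply: connect1].
  by rewrite /= eqxx.
have cP x y : connect [rel u v | (v == t1 u) || (v == t2 u)] x y ->
    c (inl x) = c (inl y).
  case/connectP=> p; elim: p x => [|z p IH] x /=; first by move=> _ ->.
  case/andP=> xz zp ly; rewrite -(IH z) //.
  by have /andP[/eqP c1 /eqP c2] := cI x; case/orP: xz => /eqP->.
(* The vertex colouring is read off at a chosen representative of each vertex; the choice is
   harmless because [c] is constant on orbits. *)
have uP v : exists u, v == incident_vertex u.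
  by have [u ->] := incident_vertexP v; exists u.
exists [ffun v => c (xchoose (uP v))]; apply/ffunP => u; rewrite !ffunE.
have /eqP := xchooseP (uP (incident_vertex u)).
case: u (xchoose _) => [x | i] [y | j] //= => [[oxy] | [->] //].
apply: cP; have : y \in orbit2 (@t1 G) (@t2 G) y by rewrite inE connect0.
by rewrite -oxy inE.
Qed.

Lemma card_pull_colouring (P : pred colouring) :
  #|[set k | P (pull_colouring k)]| = #|[set c | vertex_invariant c & P c]|.
Proof.
rewrite -(card_imset _ pull_colouring_inj); apply: eq_card => c.
rewrite [in RHS]inE; apply/imsetP/andP => [[k] | [/pull_colouringP[k ->] Pk]].
  by rewrite inE => Pk ->; split=> //; apply/pull_colouringP; exists k.
by exists k; rewrite ?inE.
Qed.

Lemma proper_pull_colouring (k : {ffun vertex G -> 'I_n}) :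
  proper_colouring (H := underlying_graph G) k
    = [forall x, pull_colouring k (inl (t0 x)) != pull_colouring k (inl x)].
Proof.
have ends2 x : (#|k @: edge_ends (edge_of x)| == 2)
    = (k (vertex_of (t0 x)) != k (vertex_of x)).
  rewrite edge_endsE imsetU1 imset_set1 cards2 [in RHS]eq_sym.
  by case: (k _ == _).
apply/forallP/forallP => /= [pk x | pk e].
  by rewrite !ffunE /= -ends2; exact: pk.
have [x ->] := orbit2_ofP e.
by have := pk x; rewrite !ffunE /= -ends2.
Qed.

End FlagColourings.

(** * Both sides as sums over flag colourings *)

Section Evaluation.

Variables (G : ribbon_graph) (n : nat).
Local Notation colouring := {ffun flag G + isolated G -> 'I_n}.
Implicit Types (c : colouring) (e : edge G) (A : {set edge G}).

Definition t1_invariant c := [forall x, c (inl (t1 x)) == c (inl x)].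

Definition straight c e :=
  [forall x in val e, c (inl (t0 x)) == c (inl x)].

Definition twisted c e :=
  [forall x in val e, c (inl (t0 (t2 x))) == c (inl x)].

(** The dual of a partial Petrial has [t2] in the role of [t0], so this is properness at [e],
    whatever the set of twisted edges. *)
Definition bicoloured c e :=
  [forall x in val e, c (inl (t2 x)) != c (inl x)].

Definition side_constant A c e := if e \in A then twisted c e else straight c e.

(** Separates the condition along [t1], which is independent of [A], from one that is local to each
    edge. *)
Lemma vertex_invariant_petrial A c :
  vertex_invariant (G := dual (partial_petrial A)) c
    = t1_invariant c && [forall e, side_constant A c e].
Proof.
have -> : [forall e, side_constant A c e]
    = [forall x, c (inl (twist A x)) == c (inl x)].
  rewrite forall_flag_edge; apply: eq_forallb => e; rewrite /side_constant.
  by case: ifP => eA; apply: eq_forallb_in => x xe;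
    rewrite /twist -(edge_of_mem xe) eA.
apply/forallP/andP => [cI | [/forallP c1 /forallP c2] x].
  by split; apply/forallP => x; have /andP[] := cI x.
by apply/andP; split; [exact: c1 | exact: c2].
Qed.

Lemma exp_n_faces_petrial A :
  (n ^ n_faces (partial_petrial A))%:R
    = \sum_c (t1_invariant c)%:R * \prod_e (side_constant A c e)%:R :> int.
Proof.
have -> : (n ^ n_faces (partial_petrial A))%N =
    #|[set c : colouring | vertex_invariant (G := dual (partial_petrial A)) c
                             & true]|.
  rewrite n_faces_dual.
  rewrite -(@card_pull_colouring (dual (partial_petrial A)) n xpredT).
  rewrite -{1}(card_ord n) -card_ffun -cardsT.
  by apply: eq_card => k; rewrite !inE.
rewrite natr_card; apply: eq_bigr => c _.
by rewrite andbT vertex_invariant_petrial -mulnb natrM natr_forall.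
Qed.

Lemma n_colourings_dual_petrial A :
  (n_colourings (underlying_graph (dual (partial_petrial A))) n)%:R
    = \sum_c (t1_invariant c)%:R
        * \prod_e ((side_constant A c e)%:R * (bicoloured c e)%:R) :> int.
Proof.
have -> : n_colourings (underlying_graph (dual (partial_petrial A))) n =
    #|[set c : colouring | vertex_invariant (G := dual (partial_petrial A)) c
                             & [forall e, bicoloured c e]]|.
  rewrite -(@card_pull_colouring (dual (partial_petrial A)) n
              (fun c => [forall e, bicoloured c e])).
  apply: eq_card => k; rewrite !inE proper_pull_colouring.
  (* Flags are grouped by the edges of [G] itself, so that the index type does not vary with [A]. *)
  exact: (@forall_flag_edge G
    (fun x => pull_colouring k (inl (t2 x)) != pull_colouring k (inl x))).
rewrite natr_card; apply: eq_bigr => c _.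
rewrite vertex_invariant_petrial -andbA -!mulnb !natrM !natr_forall.
by rewrite big_split.
Qed.

(** If [x] and [t2 x] share a colour, each of [straight] and [twisted] says that all four corners of
    [e] have that colour. *)
Lemma bicoloured_straight_twisted c e :
  ((twisted c e)%:R - (straight c e)%:R) * (bicoloured c e)%:R
    = (twisted c e)%:R - (straight c e)%:R :> int.
Proof.
have [_ | ] := boolP (bicoloured c e); first by rewrite mulr1.
rewrite negb_forall_in => /exists_inP[x xe]; rewrite negbK => /eqP c2.
rewrite mulr0 (_ : twisted c e = straight c e) ?subrr //.
rewrite (edge_of_mem xe) /twisted /straight !forall_edge_of.
rewrite !t02C !t2K !t0K c2 -!t02C ?t2K.
by do ?[case: eqP => //= ?]; congruence.
Qed.

(** Expanding the product, [A] is the set of edges where the term of [twisted] is picked, each with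
    a sign. The weight [w] is 1 for the Penrose side and the indicator of [bicoloured] for the
    chromatic side. *)
Lemma sum_side_constant c (w : edge G -> int) :
  \sum_(A : {set edge G}) (-1) ^+ #|A| * \prod_e ((side_constant A c e)%:R * w e)
    = \prod_e (((straight c e)%:R - (twisted c e)%:R) * w e).
Proof.
(* [bigA_distr] picks the first summand on [A], so the term of [twisted] must come first. *)
under [RHS]eq_bigr do rewrite addrC mulrDl.
rewrite bigA_distr; apply: eq_bigr => A _.
rewrite -prodr_const big_mkcond -big_split /=; apply: eq_bigr => e _.
by rewrite /side_constant; case: ifP => _; rewrite ?mul1r // mulN1r mulNr.
Qed.

Lemma alternating_count_eq :
  \sum_(A : {set edge G}) (-1) ^+ #|A| * (n ^ n_faces (partial_petrial A))%:R
    = \sum_(A : {set edge G}) (-1) ^+ #|A|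
        * (n_colourings (underlying_graph (dual (partial_petrial A))) n)%:R
    :> int.
Proof.
have factor (w : colouring -> edge G -> int) :
    \sum_(A : {set edge G}) (-1) ^+ #|A| * (\sum_c (t1_invariant c)%:R
        * \prod_e ((side_constant A c e)%:R * w c e))
    = \sum_c (t1_invariant c)%:R
        * \prod_e (((straight c e)%:R - (twisted c e)%:R) * w c e).
  under eq_bigr do rewrite mulr_sumr.
  rewrite exchange_big; apply: eq_bigr => c _.
  rewrite -sum_side_constant mulr_sumr; apply: eq_bigr => A _.
  by rewrite mulrCA.
under [RHS]eq_bigr do rewrite n_colourings_dual_petrial.
rewrite (factor (fun c e => (bicoloured c e)%:R)).
transitivity (\sum_(A : {set edge G}) (-1) ^+ #|A| * (\sum_c (t1_invariant c)%:R
    * \prod_e ((side_constant A c e)%:R * 1)) : int).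
  apply: eq_bigr => A _; rewrite exp_n_faces_petrial; congr (_ * _).
  by apply: eq_bigr => c _; under [in RHS]eq_bigr do rewrite mulr1.
rewrite (factor (fun _ _ => 1)); apply: eq_bigr => c _; congr (_ * _).
apply: eq_bigr => e _; rewrite mulr1 -opprB mulNr.
by rewrite bicoloured_straight_twisted.
Qed.

End Evaluation.

Theorem theorem5p3 (G : ribbon_graph) :
  penrose_poly G =
    \sum_(A : {set edge G})
      (-1) ^+ #|A| *
      chromatic_poly (underlying_graph (dual (partial_petrial A))).
Proof.
apply: poly_eq_on_nat => n.
have signE m : ((-1) ^+ m).[n%:R] = (-1) ^+ m :> int.
  by rewrite horner_exp hornerN hornerC.
rewrite /penrose_poly !horner_sum.
under eq_bigr do rewrite hornerM hornerXn signE -natrX.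
under [RHS]eq_bigr do rewrite hornerM signE chromatic_polyE.
exact: alternating_count_eq.
Qed.
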